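(* Let $k \geq 1$, and let $q_{0}, \dots, q_{k-1} \in \mathbb{N}^{*}$ be free ultrafilters on $\mathbb{N}$ with $E_{t}^{(k)} \in q_{t}$ for each $t \in \{0, \dots, k-1\}$. Then $$p := q_{0} + q_{1} + \cdots + q_{k-1} \in \Pi_{k} \setminus \Pi_{k+1}.$$
   Context: $\mathbb{N} = \{1,2,3,\dots\}$ is discrete; $\beta\mathbb{N}$ is the space of ultrafilters on $\mathbb{N}$, with basis of clopen sets $\overline{A} = \{p \in \beta\mathbb{N} : A \in p\}$ for $A \subseteq \mathbb{N}$; each $n\in\mathbb{N}$ is identified with the principal ultrafilter at $n$, and $\mathbb{N}^{*} = \beta\mathbb{N} \setminus \mathbb{N}$ is the set of free (non-principal) ultrafilters. Addition on $\beta\mathbb{N}$ is defined by $A \in p + q \iff \{n \in \mathbb{N} : -n + A \in q\} \in p$, where $-n + A = \{m \in \mathbb{N} : n + m \in A\}$; it is associative, and for each fixed $q$ the map $p \mapsto p+q$ is continuous. The pure filtration is defined for $k \geq 1$ by $\Pi_{k} = \overline{\mathbb{N}^{*} + \cdots + \mathbb{N}^{*}}$ ($k$ summands), i.e. the closure in $\beta\mathbb{N}$ of $\{u_1 + \cdots + u_k : u_1, \dots, u_k \in \mathbb{N}^{*}\}$. Let $e_{n} = 2^{2^{n}}$ for $n \geq 1$. For $k \geq 1$ and $t \in \{0, \dots, k-1\}$, $E_{t}^{(k)} = \{ e_{n} : n \geq 1,\ n \equiv t \pmod k \}$. *)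

(* Defs.v *)
From HB Require Import structures.
From mathcomp Require Import all_boot.
From mathcomp Require Import all_classical.
From mathcomp Require Import topology_structure.

Set Implicit Arguments.
Unset Strict Implicit.
Unset Printing Implicit Defensive.

Local Open Scope classical_set_scope.

(* The natural numbers here start at 1. *)
Definition pnat : Type := {n : nat | 0 < n}.

Definition addp (n m : pnat) : pnat :=
  exist (fun i => is_true (0 < i)) (val n + val m) (ltn_addr (val m) (valP n)).

Record betaN : Type := BetaN {
  ultra :> (pnat -> Prop) -> Prop;
  ultra_ultra : UltraFilter ultra
}.

#[global] Existing Instance ultra_ultra.

Lemma betaN_ext (p q : betaN) : (forall A : set pnat, p A <-> q A) -> p = q.
Proof.
case: p q => [F FU] [G GU] /= FG.
have eFG : F = G by apply/funext => A; apply/propext/FG.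
case: G / eFG GU {FG} => GU.
by congr BetaN; exact: Prop_irrelevance.
Qed.

HB.instance Definition _ := gen_eqMixin betaN.
HB.instance Definition _ := gen_choiceMixin betaN.

(* The clopen set written as A with an overline. *)
Definition basic_open (A : set pnat) : set betaN := [set p | p A].

Lemma basic_open_cover : \bigcup_(A in [set: set pnat]) basic_open A = setT.
Proof.
by apply/seteqP; split=> // p _; exists setT => //; exact: filterT.
Qed.

Lemma basic_open_join (A B : set pnat) (p : betaN) :
  [set: set pnat] A -> [set: set pnat] B -> basic_open A p -> basic_open B p ->
  exists C, [/\ [set: set pnat] C, basic_open C p
              & basic_open C `<=` basic_open A `&` basic_open B].
Proof.
move=> _ _ pA pB; exists (A `&` B); split=> //; first exact: (@filterI _ p _ A B).
move=> q qAB; split.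
  exact: (@filterS _ q _ (A `&` B) A (@subIsetl _ A B)).
exact: (@filterS _ q _ (A `&` B) B (@subIsetr _ A B)).
Qed.

HB.instance Definition _ :=
  isBaseTopological.Build betaN basic_open_cover basic_open_join.

Definition principal (n : pnat) : betaN := BetaN (principal_filter_ultra n).

Definition Nstar : set betaN := ~` range principal.

(* The set -n + A. *)
Definition shift (n : pnat) (A : set pnat) : set pnat :=
  [set m | A (addp n m)].

Definition beta_add_sets (p q : betaN) : set_system pnat :=
  [set A | p [set n | q (shift n A)]].

Lemma beta_add_ultra (p q : betaN) : UltraFilter (beta_add_sets p q).
Proof.
have FF : ProperFilter (beta_add_sets p q).
  apply: Build_ProperFilter_ex.
    move=> A pA; have [n qn] := @filter_ex _ p _ _ pA.
    by have [m Am] := @filter_ex _ q _ _ qn; exists (addp n m).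
  split.
  - by apply: (@filterE _ p) => n; exact: (@filterT _ q).
  - move=> A B pA pB; apply: (@filterS2 _ p _ _ _ _ _ pA pB) => n qA qB.
    exact: (@filterI _ q _ _ _ qA qB).
  - move=> A B AB; apply: (@filterS _ p) => n; apply: (@filterS _ q) => m.
    exact: AB.
split=> // G GF FG; apply/seteqP; split=> // A GA.
have [//|pnA] := in_ultra_setVsetC [set n | q (shift n A)] (ultra_ultra p).
suff /FG GnA : beta_add_sets p q (~` A).
  by have [n []] := @filter_ex _ G _ _ (@filterI _ G _ _ _ GA GnA).
apply: (@filterS _ p _ _ _ _ pnA) => n /= nqA.
by have [] := in_ultra_setVsetC (shift n A) (ultra_ultra q).
Qed.

Definition beta_add (p q : betaN) : betaN := BetaN (beta_add_ultra p q).

Lemma shiftD (n m : pnat) (A : set pnat) :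
  shift m (shift n A) = shift (addp n m) A.
Proof.
apply/funext => l; rewrite /shift /=; congr A.
by apply: val_inj; rewrite /= addnA.
Qed.

Lemma beta_addA : associative beta_add.
Proof.
move=> p q r; apply: betaN_ext => A; rewrite /= /beta_add_sets /=.
by split; apply: (@filterS _ p) => n; apply: (@filterS _ q) => m;
  rewrite /= shiftD.
Qed.

(* [sumb k u] is [u 0 + ... + u k.-1], defined for [0 < k]: the positive
   integers having no zero, [betaN] has no neutral element, and [sumb 0 u] is
   only a default value. *)
Fixpoint sumb (k : nat) (u : nat -> betaN) : betaN :=
  match k with
  | 0 | 1 => u 0
  | k'.+1 => beta_add (sumb k' u) (u k')
  end.

Definition Pi (k : nat) : set betaN :=
  closure [set sumb k u | u in [set u | forall i, i < k -> Nstar (u i)]].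

Definition e (n : pnat) : pnat :=
  exist (fun i => is_true (0 < i)) (2 ^ (2 ^ val n)) (expn_gt0 2 (2 ^ val n)).

Definition E (k t : nat) : set pnat :=
  [set e n | n in [set n : pnat | val n = t %[mod k]]].

(* Main.v *)
(** Let [near_pow2_sum k M] be the set of integers at distance at most [M] from
    a sum of at most [k] powers of two.  Then [p] contains [near_pow2_sum k 0],
    whereas a sum of [k + 1] free ultrafilters contains no [near_pow2_sum k M].
    The latter goes by induction on [k]: if [u + w] contains
    [near_pow2_sum k M] with [u] free, there are [x] and [x'] far apart such
    that, for [w]-many [y], both [y + x] and [y + x'] are within [M] of sums [z]
    and [z'] of at most [k] powers of two.  Thus [z] and [z'] are distinct at
    distance bounded by some [N]; they cannot both be multiples of [2 ^ N], so
    one of them has a summand less than [2 ^ N], and dropping this summand shows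
    that [y] lies in [near_pow2_sum k.-1 M'] with [M'] independent of [y]. *)
Require Import Defs.
From mathcomp Require Import all_boot all_classical.
From mathcomp Require Import topology_structure.
From mathcomp Require Import zify.

Local Open Scope classical_set_scope.

Local Notation pnat := Defs.pnat.

Lemma Nstar_not_set1 (u : betaN) (n : pnat) : Nstar u -> ~ u [set n].
Proof.
move=> uN un; apply: uN; exists n => //; apply: betaN_ext => A; split.
  move=> /principal_filterP An.
  by apply: (@filterS _ u _ _ _ _ un) => _ ->.
move=> uA; have [m [-> Am]] := @filter_ex _ u _ _ (@filterI _ u _ _ _ un uA).
exact/principal_filterP.
Qed.

Lemma Nstar_gt (u : betaN) (M : nat) : Nstar u -> u [set y : pnat | M < val y].
Proof.
move=> uN; elim: M => [|M IH]; first by apply: (@filterE _ u) => y; exact: valP.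
have uC : u (~` [set y : pnat | val y = M.+1]).
  have [uM|//] := in_ultra_setVsetC [set y : pnat | val y = M.+1] (ultra_ultra u).
  have := @Nstar_not_set1 u (exist (fun i => is_true (0 < i)) M.+1 (ltn0Sn M)) uN.
  case; apply: (@filterS _ u _ _ _ _ uM) => y /= yM.
  exact: val_inj.
apply: (@filterS2 _ u _ _ _ _ _ IH uC) => y /= My nyM.
by rewrite ltn_neqAle My andbT; apply/eqP => yM; exact: nyM.
Qed.

(** [sumb] nests to the left, whereas the induction must fix values of the first summand and keep
    the others as one ultrafilter. *)
Lemma sumbS (k : nat) (u : nat -> betaN) :
  sumb k.+2 u = beta_add (u 0) (sumb k.+1 (fun i => u i.+1)).
Proof.
elim: k => [//|k IH].
have -> : sumb k.+3 u = beta_add (sumb k.+2 u) (u k.+2) by [].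
by rewrite IH -beta_addA.
Qed.

Definition pow2_sum (s : seq nat) : nat := \sum_(n <- s) 2 ^ n.

Definition near_pow2_sum (k M : nat) : set pnat :=
  [set y | exists s : seq nat, [/\ size s <= k,
     val y <= pow2_sum s + M & pow2_sum s <= val y + M]].

Lemma dvdn_pow2_sum (N : nat) (s : seq nat) :
  all (leq N) s -> 2 ^ N %| pow2_sum s.
Proof.
move=> /allP Ns; rewrite /pow2_sum big_seq; apply: dvdn_sum => n /Ns.
exact: dvdn_exp2l.
Qed.

Lemma pow2_sum_rem (n : nat) (s : seq nat) :
  n \in s -> pow2_sum s = 2 ^ n + pow2_sum (rem n s).
Proof. by move=> ns; rewrite /pow2_sum (perm_big _ (perm_to_rem ns)) big_cons. Qed.

Lemma near_pow2_sum_drop (k M N : nat) (s : seq nat) (y : pnat) :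
  size s <= k.+1 -> ~~ all (leq N) s ->
  val y <= pow2_sum s + M -> pow2_sum s <= val y + M ->
  near_pow2_sum k (M + 2 ^ N) y.
Proof.
move=> sk /allPn[n ns]; rewrite -ltnNge => nN.
have : 2 ^ n <= 2 ^ N by rewrite leq_exp2l // ltnW.
rewrite (pow2_sum_rem _ _ ns) => *; exists (rem n s).
rewrite size_rem //; split; [by case: (size s) sk | lia | lia].
Qed.

(** The difference is a multiple of [2 ^ N] and at most [N < 2 ^ N], hence zero. *)
Lemma pow2_sum_close (N : nat) (s s' : seq nat) :
  all (leq N) s -> all (leq N) s' ->
  pow2_sum s <= pow2_sum s' -> pow2_sum s' <= pow2_sum s + N ->
  pow2_sum s = pow2_sum s'.
Proof.
move=> /dvdn_pow2_sum ds /dvdn_pow2_sum ds' ss' s's.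
have := dvdn_sub ds' ds; have := ltn_expl N (ltnSn 1).
move=> N2 /dvdn_leq; lia.
Qed.

Lemma sum_Nstar_not_near (k M : nat) (u : nat -> betaN) :
  (forall i, i < k.+1 -> Nstar (u i)) -> ~ sumb k.+1 u (near_pow2_sum k M).
Proof.
elim: k M u => [|k IH] M u uN.
  move=> /= u0; have := Nstar_gt _ M (uN 0 (ltn0Sn 0)).
  move=> /(@filterI _ (u 0) _ _ _ u0)/(@filter_ex _ (u 0))[y [[s []]]].
  by rewrite leqn0 => /nilP ->; rewrite /pow2_sum big_nil /= => *; lia.
rewrite sumbS; set w := sumb _ _ => uw.
have u0 := uN 0 (ltn0Sn _).
have [x wx] := @filter_ex _ (u 0) _ _ uw.
(* The gap [M + M] will force [z < z'], as [z <= y + x + M < y + x' - M <= z']. *)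
have [x' [wx' xx']] := @filter_ex _ (u 0) _ _
  (@filterI _ (u 0) _ _ _ uw (Nstar_gt _ (val x + M + M) u0)).
(* This bounds [z' - z], which is at most [x' - x + M + M]. *)
pose N := val x' + M + M.
apply: (IH (M + val x' + 2 ^ N) (fun i => u i.+1)) => [i ik|]; first exact: uN.
apply: (@filterS2 _ w _ _ _ _ _ wx wx').
move=> y [s [sk ys sy]] [s' [s'k ys' s'y]].
rewrite /= in xx' ys sy ys' s'y.
(* Since [x < x'], both [z] and [z'] are within [M + x'] of [y]; dropping a small summand costs at
   most [2 ^ N] more. *)
have [sN|/near_pow2_sum_drop] := boolP (all (leq N) s); last by apply=> //=; lia.
have [s'N|/near_pow2_sum_drop] := boolP (all (leq N) s'); last by apply=> //=; lia.
have := pow2_sum_close _ _ _ sN s'N; rewrite /N /=; lia.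
Qed.

Lemma sum_pow2_near (k : nat) (u : nat -> betaN) :
  (forall i, i < k.+1 -> u i [set y : pnat | exists n, val y = 2 ^ n]) ->
  sumb k.+1 u (near_pow2_sum k.+1 0).
Proof.
elim: k => [|k IH] uP.
  apply: (@filterS _ (u 0) _ _ _ _ (uP 0 (ltn0Sn 0))) => y [n yn].
  by exists [:: n]; rewrite /pow2_sum big_seq1 yn !addn0.
have /IH : forall i, i < k.+1 -> u i [set y : pnat | exists n, val y = 2 ^ n].
  by move=> i ik; apply: uP; exact: ltnW.
apply: (@filterS _ (sumb k.+1 u)) => x [s [/= sk xs sx]].
apply: (@filterS _ (u k.+1) _ _ _ _ (uP k.+1 (ltnSn _))) => y [n /= yn].
exists (n :: s); rewrite /pow2_sum big_cons -/(pow2_sum s).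
split; rewrite /= ?yn; lia.
Qed.

Theorem mainTheorem4 (k : nat) (hk : 1 <= k) (q : nat -> betaN)
    (q_free : forall t, t < k -> Nstar (q t))
    (q_E : forall t, t < k -> q t (E k t)) :
  (Pi k `\` Pi k.+1) (sumb k q).
Proof.
split; first by apply: subset_closure; exists q.
case: k hk q_free q_E => // k _ _ q_E cl.
have p_near : sumb k.+1 q (near_pow2_sum k.+1 0).
  apply: sum_pow2_near => i /q_E; apply: (@filterS _ (q i)) => _ [n _ <-].
  by exists (2 ^ val n).
have near_nbhs : nbhs (sumb k.+1 q) (basic_open (near_pow2_sum k.+1 0)).
  rewrite nbhsE; exists (basic_open (near_pow2_sum k.+1 0)) => //; split=> //.
  exists [set near_pow2_sum k.+1 0] => //.
  by rewrite bigcup_set1.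
(* Being a neighbourhood of a point of the closure, this basic open set contains an actual sum of
   [k.+2] free ultrafilters. *)
have [_ [[u uN <-]]] := cl _ near_nbhs.
exact: sum_Nstar_not_near.
Qed.
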